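(* Let $G$ be a triangle-free subdivision of $K_4$. Then $G$ is a restricted frame graph if and only if either (1) $G$ is obtained from $K_4$ by subdividing at most $3$ of its $6$ edges, or (2) $G$ is obtained from $K_4$ by subdividing exactly $4$ of its edges and the two non-subdivided edges share a vertex.
   Context: A subdivision of $K_4$ is obtained by replacing each edge of $K_4$ by a path; an edge is subdivided if its path has at least two edges. A frame is the boundary of an axis-parallel box $I\times J\subset\mathbb R^2$. A graph $G$ is a restricted frame graph if there is a family of frames $\{F_v : v\in V(G)\}$ with $uv\in E(G)$ iff $F_u\cap F_v\neq\emptyset$, satisfying: (1) corners of a frame do not coincide with any point of another frame; (2) the left side of any frame does not intersect any other frame; (3) if the right side of a frame intersects a second frame, this right side intersects both the top and the bottom side of the second frame; (4) if two frames have non-empty intersection, then no frame is entirely contained in the intersection of the two regions bounded by these two frames. *)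

(* Defs.v *)
From Stdlib Require Import Reals.
From mathcomp Require Import all_boot.
Set Implicit Arguments. Unset Strict Implicit. Unset Printing Implicit Defensive.

Definition triangle_free (T : finType) (e : rel T) : Prop :=
  forall x y z : T, ~ (e x y /\ e y z /\ e z x).

Definition consec (T : eqType) (L : seq T) (x y : T) : Prop :=
  exists k, (k.+1 < size L)%N /\ nth x L k = x /\ nth x L k.+1 = y.

(* Witness that (T,e) is a subdivision of K4: the branch vertices are
   b 0, .., b 3, and for i < j the edge ij of K4 is replaced by the path
   b i :: s i j ++ [:: b j]  (s i j = sequence of internal vertices). *)
Definition K4path (T : finType) (b : 'I_4 -> T) (s : 'I_4 -> 'I_4 -> seq T)
  (i j : 'I_4) : seq T := b i :: rcons (s i j) (b j).

Definition K4_subdivision_witness (T : finType) (e : rel T)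
  (b : 'I_4 -> T) (s : 'I_4 -> 'I_4 -> seq T) : Prop :=
  injective b /\
  (forall i j : 'I_4, (i < j)%N -> uniq (s i j)) /\
  (forall (i j : 'I_4) (k : 'I_4), (i < j)%N -> b k \notin s i j) /\
  (forall i j k l : 'I_4, (i < j)%N -> (k < l)%N -> (i, j) <> (k, l) ->
      forall x, x \in s i j -> x \notin s k l) /\
  (forall x : T, (exists k, x = b k) \/
                 (exists i j : 'I_4, (i < j)%N /\ x \in s i j)) /\
  (forall x y : T, e x y <->
      exists i j : 'I_4, (i < j)%N /\
        (consec (K4path b s i j) x y \/ consec (K4path b s i j) y x)).

Definition is_K4_subdivision (T : finType) (e : rel T) : Prop :=
  exists b s, @K4_subdivision_witness T e b s.

Definition subdivided (T : finType) (s : 'I_4 -> 'I_4 -> seq T) (i j : 'I_4) : bool :=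
  if (i < j)%N then s i j != [::] else s j i != [::].

Definition num_subdivided (T : finType) (s : 'I_4 -> 'I_4 -> seq T) : nat :=
  #|[set p : 'I_4 * 'I_4 | (p.1 < p.2)%N && subdivided s p.1 p.2]|.

Definition nonsubdivided_share_vertex (T : finType) (s : 'I_4 -> 'I_4 -> seq T) : Prop :=
  exists a c d : 'I_4, [/\ a != c, a != d, c != d,
                           ~~ subdivided s a c & ~~ subdivided s a d].

(* Frames: boundaries of axis-parallel boxes [x1,x2] x [y1,y2].         *)

Record frame := Frame { fx1 : R; fx2 : R; fy1 : R; fy2 : R }.

Definition frame_ok (F : frame) : Prop :=
  Rlt (fx1 F) (fx2 F) /\ Rlt (fy1 F) (fy2 F).

Definition between (a t c : R) : Prop := Rle a t /\ Rle t c.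

Definition on_left (F : frame) (p : R * R) : Prop :=
  p.1 = fx1 F /\ between (fy1 F) p.2 (fy2 F).
Definition on_right (F : frame) (p : R * R) : Prop :=
  p.1 = fx2 F /\ between (fy1 F) p.2 (fy2 F).
Definition on_bottom (F : frame) (p : R * R) : Prop :=
  p.2 = fy1 F /\ between (fx1 F) p.1 (fx2 F).
Definition on_top (F : frame) (p : R * R) : Prop :=
  p.2 = fy2 F /\ between (fx1 F) p.1 (fx2 F).

Definition on_frame (F : frame) (p : R * R) : Prop :=
  on_left F p \/ on_right F p \/ on_bottom F p \/ on_top F p.

Definition in_region (F : frame) (p : R * R) : Prop :=
  between (fx1 F) p.1 (fx2 F) /\ between (fy1 F) p.2 (fy2 F).

Definition is_corner (F : frame) (p : R * R) : Prop :=
  (p.1 = fx1 F \/ p.1 = fx2 F) /\ (p.2 = fy1 F \/ p.2 = fy2 F).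

Definition meets (P Q : R * R -> Prop) : Prop := exists p, P p /\ Q p.

Definition restricted_frame_graph (T : finType) (e : rel T) : Prop :=
  exists F : T -> frame,
  (forall v, frame_ok (F v)) /\
      (forall u v, u <> v -> (e u v <-> meets (on_frame (F u)) (on_frame (F v)))) /\
      (forall u v, u <> v -> forall p, is_corner (F u) p -> ~ on_frame (F v) p) /\
      (forall u v, u <> v -> ~ meets (on_left (F u)) (on_frame (F v))) /\
      (forall u v, u <> v -> meets (on_right (F u)) (on_frame (F v)) ->
          meets (on_right (F u)) (on_bottom (F v)) /\
          meets (on_right (F u)) (on_top (F v))) /\
      (forall u v w, u <> v -> meets (on_frame (F u)) (on_frame (F v)) ->
          w <> u -> w <> v ->
          ~ (forall p, on_frame (F w) p -> in_region (F u) p /\ in_region (F v) p)).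

(* Main.v *)
Require Import Defs.
From Stdlib Require Import Reals Lra.
From mathcomp Require Import all_boot zify.
Set Implicit Arguments. Unset Strict Implicit. Unset Printing Implicit Defensive.

(** Both conditions say that some branch vertex has two unsubdivided edges.

    Two adjacent frames u, v satisfy x1 u < x1 v < x2 u < x2 v, or the converse, with the
    vertical range of v inside that of u; two non-adjacent frames are nested or apart.  If no
    branch vertex has two unsubdivided edges, the non-neighbours of any vertex v induce a
    connected graph, so a frame enclosing one of its non-neighbours encloses all of them, and
    by axiom (4) at most one frame encloses another.  But every cycle contains an enclosing
    frame, and no vertex lies on all cycles of the subdivision.

    Conversely, let ac and ad be unsubdivided, let f be the fourth branch vertex, and let w be
    the neighbour of c on the path from d to c.  Three vertically disjoint lanes of boxes leave
    the right side of the frame of f (Root): lane 0 ends with c, lane 1 passes through d and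
    ends next to w, lane 2 runs towards a.  The frame of w (Outer) encloses the frame of a
    (Inner), and their right sides meet exactly the boxes of their neighbours in the lanes;
    Root lies inside Inner, except when af is unsubdivided and Inner sticks out of Root. *)

(** * Pairs of frames *)

Section FramePairs.
Open Scope R_scope.

Definition frame_arc (F G : frame) : Prop :=
  fx1 F < fx1 G < fx2 F /\ fx2 F < fx2 G /\ fy1 F < fy1 G /\ fy2 G < fy2 F.

Definition frame_linked (F G : frame) : Prop := frame_arc F G \/ frame_arc G F.

Definition frame_inside (F G : frame) : Prop :=
  fx1 G < fx1 F /\ fx2 F < fx2 G /\ fy1 G < fy1 F /\ fy2 F < fy2 G.

Definition frame_apart (F G : frame) : Prop :=
  fx2 F < fx1 G \/ fx2 G < fx1 F \/ fy2 F < fy1 G \/ fy2 G < fy1 F.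

Definition frame_separate (F G : frame) : Prop :=
  frame_inside F G \/ frame_inside G F \/ frame_apart F G.

Definition restricted_pair (F G : frame) : Prop :=
  [/\ forall p, is_corner F p -> ~ on_frame G p,
      ~ meets (on_left F) (on_frame G) &
      meets (on_right F) (on_frame G) ->
        meets (on_right F) (on_bottom G) /\ meets (on_right F) (on_top G)].

End FramePairs.

Ltac frame_lra :=
  unfold frame_separate, frame_linked, frame_ok, frame_arc, frame_inside, frame_apart,
    is_corner, on_frame, on_left, on_right, on_bottom, on_top, in_region, between in *;
  simpl in *; lra.

Lemma corner_on_frame (F : frame) p : frame_ok F -> is_corner F p -> on_frame F p.
Proof. by case: p => x y okF corner; frame_lra. Qed.

Section TwoFrames.
Variables F G : frame.
Hypotheses (okF : frame_ok F) (okG : frame_ok G).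

Lemma frame_linked_meets : frame_linked F G -> meets (on_frame F) (on_frame G).
Proof. by case=> arc; [exists (fx2 F, fy1 G)|exists (fx2 G, fy1 F)]; frame_lra. Qed.

Lemma frame_separate_not_meets : frame_separate F G -> ~ meets (on_frame F) (on_frame G).
Proof. by move=> sep [[x y] [onF onG]]; frame_lra. Qed.

Lemma not_meets_frame_separate :
  ~ meets (on_frame F) (on_frame G) -> frame_separate F G.
Proof.
move=> miss.
have missFG x y : x = fx1 F \/ x = fx2 F -> y = fy1 G \/ y = fy2 G ->
    between (fx1 G) x (fx2 G) -> between (fy1 F) y (fy2 F) -> False.
  by move=> ? ? ? ?; apply: miss; exists (x, y); frame_lra.
have missGF x y : x = fx1 G \/ x = fx2 G -> y = fy1 F \/ y = fy2 F ->
    between (fx1 F) x (fx2 F) -> between (fy1 G) y (fy2 G) -> False.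
  by move=> ? ? ? ?; apply: miss; exists (x, y); frame_lra.
move: (missFG (fx1 F) (fy1 G)) (missFG (fx1 F) (fy2 G)) (missFG (fx2 F) (fy1 G))
  (missFG (fx2 F) (fy2 G)) (missGF (fx1 G) (fy1 F)) (missGF (fx1 G) (fy2 F))
  (missGF (fx2 G) (fy1 F)) (missGF (fx2 G) (fy2 F)) => *.
by clear miss missFG missGF; frame_lra.
Qed.

Lemma frame_linked_restricted_pair : frame_linked F G -> restricted_pair F G.
Proof.
move=> linked; split.
- by move=> [x y] corner onG; frame_lra.
- by move=> [[x y] [onF onG]]; frame_lra.
- move=> [[x y] [onF onG]].
  by split; [exists (fx2 F, fy1 G)|exists (fx2 F, fy2 G)]; frame_lra.
Qed.

Lemma not_meets_restricted_pair :
  ~ meets (on_frame F) (on_frame G) -> restricted_pair F G.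
Proof.
move=> miss; split.
- by move=> p corner onG; apply: miss; exists p; split=> //; apply: corner_on_frame.
- by move=> [p [onF onG]]; apply: miss; exists p; split=> //; left.
- by move=> [p [onF onG]]; case: miss; exists p; split=> //; right; left.
Qed.

Lemma region_bounds :
  (forall p, on_frame G p -> in_region F p) ->
  between (fx1 F) (fx1 G) (fx2 G) /\ Rle (fx2 G) (fx2 F) /\
  between (fy1 F) (fy1 G) (fy2 G) /\ Rle (fy2 G) (fy2 F).
Proof.
move=> sub; have low := sub (fx1 G, fy1 G); have high := sub (fx2 G, fy2 G).
frame_lra.
Qed.

Lemma right_meets_frame_arc : restricted_pair F G -> restricted_pair G F ->
  meets (on_right F) (on_frame G) -> frame_arc F G.
Proof.
move=> [cornerF left_free right_through] [cornerG _ _].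
move=> /right_through[[[x y] [rightF bottomG]] [[x' y'] [rightF' topG]]].
split; first split; last split; last split; apply: Rnot_le_lt => ?.
- by apply: left_free; exists (fx1 F, fy1 G); split; [|right; right; left]; frame_lra.
- by apply: (cornerG (fx1 G, fy1 G)); [split; left|right; left; frame_lra].
- by apply: (cornerG (fx2 G, fy1 G)); [split; [right|left]|right; left; frame_lra].
- by apply: (cornerF (fx2 F, fy1 F)); [split; [right|left]|right; right; left; frame_lra].
- by apply: (cornerF (fx2 F, fy2 F)); [split; right|right; right; right; frame_lra].
Qed.

End TwoFrames.

Lemma restricted_meets_frame_linked (F G : frame) : frame_ok F -> frame_ok G ->
  restricted_pair F G -> restricted_pair G F ->
  meets (on_frame F) (on_frame G) -> frame_linked F G.
Proof.
move=> okF okG restrFG restrGF [[x y] [onF onG]].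
have [cornerF leftF _] := restrFG; have [cornerG leftG _] := restrGF.
case: (onF) => [onleft|[onright|horF]]; first by case: leftF; exists (x, y).
  by left; apply: right_meets_frame_arc => //; exists (x, y).
case: (onG) => [onleft|[onright|horG]]; first by case: leftG; exists (x, y).
  by right; apply: right_meets_frame_arc => //; exists (x, y).
(* Two horizontal sides on the same line overlap, so one starts on the other. *)
exfalso; have [le|lt] := Rle_or_lt (fx1 F) (fx1 G).
- by apply: (cornerG (fx1 G, y)); [|right; right]; frame_lra.
- by apply: (cornerF (fx1 F, y)); [|right; right]; frame_lra.
Qed.

(** * Frame layouts of a graph *)

Record frame_layout (T : finType) (e : rel T) (F : T -> frame) : Prop := FrameLayout {
  layout_ok : forall v, frame_ok (F v);
  layout_edge : forall u v, u != v -> e u v -> frame_linked (F u) (F v);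
  layout_nonedge : forall u v, u != v -> ~~ e u v -> frame_separate (F u) (F v);
  layout_nest : forall u v w, u != v -> e u v ->
    frame_inside (F w) (F u) -> frame_inside (F w) (F v) -> False }.

Lemma restricted_frame_graph_layout (T : finType) (e : rel T) :
  restricted_frame_graph e -> exists F : T -> frame, frame_layout e F.
Proof.
move=> [F [ok [edge [corner [left_free [right_through nest]]]]]]; exists F.
have restr u v : u != v -> restricted_pair (F u) (F v).
  by move=> /eqP uv; split; [exact: corner|exact: left_free|exact: right_through].
split=> // u v.
- move=> uv euv; apply: restricted_meets_frame_linked (restr _ _ uv) _ _ => //.
    by apply: restr; rewrite eq_sym.
  by apply/edge => //; apply/eqP.
- move=> uv /negP nuv; apply: not_meets_frame_separate => // mt.
  by apply: nuv; apply/edge => //; apply/eqP.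
move=> w /eqP uv /(edge _ _ uv) mt wu wv; have okw := ok w.
apply: (nest u v w uv mt) => [wE|wE|[x y] onw]; [rewrite wE in wu|rewrite wE in wv|]; frame_lra.
Qed.

Lemma layout_restricted_frame_graph (T : finType) (e : rel T) (F : T -> frame) :
  frame_layout e F -> restricted_frame_graph e.
Proof.
move=> [ok edge nonedge nest]; exists F.
have edgeP u v : u <> v -> e u v <-> meets (on_frame (F u)) (on_frame (F v)).
  move=> /eqP uv; split=> [|mt]; first by move/(edge _ _ uv); apply: frame_linked_meets.
  by apply/negPn/negP => /(nonedge _ _ uv)/frame_separate_not_meets; apply.
have restr u v : u <> v -> restricted_pair (F u) (F v).
  move=> uv; have [euv|nuv] := boolP (e u v).
    by apply: frame_linked_restricted_pair => //; apply: edge euv; apply/eqP.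
  apply: not_meets_restricted_pair => // /edgeP euv.
  by rewrite (euv uv) in nuv.
have insideP w x : w <> x -> (forall p, on_frame (F w) p -> in_region (F x) p) ->
    frame_inside (F w) (F x).
  move=> /eqP wx sub; have bounds := region_bounds (ok w) sub.
  have okw := ok w; have okx := ok x; have := edge _ _ wx; have := nonedge _ _ wx.
  case: (e w x) => /= [_ /(_ isT)|/(_ isT) + _]; frame_lra.
split=> //; split=> //; split; last split; last split.
- by move=> u v /restr[].
- by move=> u v /restr[].
- by move=> u v /restr[].
move=> u v w uv /(edgeP _ _ uv) euv wu wv sub; move/eqP: uv => uv.
by apply: (nest u v w) => //; apply: insideP => // p /sub[].
Qed.

Definition nonneighbour (T : finType) (e : rel T) (v x : T) : bool := (x != v) && ~~ e v x.

Definition nonneighbour_edge (T : finType) (e : rel T) (v : T) : rel T :=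
  [rel x y | [&& e x y, nonneighbour e v x & nonneighbour e v y]].

Lemma nonneighbour_walk (T : finType) (e : rel T) (v x : T) (L : seq T) :
  path e x L -> all (nonneighbour e v) (x :: L) ->
  connect (nonneighbour_edge e v) x (last x L).
Proof.
move=> path_L all_L; apply/connectP; exists L => //.
apply: sub_in_path all_L path_L => y z vy vz yz.
exact/and3P.
Qed.

Lemma nonneighbour_connect_sym (T : finType) (e : rel T) (v : T) :
  symmetric e -> connect_sym (nonneighbour_edge e v).
Proof.
move=> e_sym; apply: sym_connect_sym => x y; rewrite /nonneighbour_edge /= e_sym.
by congr (_ && _); rewrite andbC.
Qed.

Lemma nonneighbour_sym (T : finType) (e : rel T) (v x : T) :
  symmetric e -> nonneighbour e v x = nonneighbour e x v.
Proof. by move=> e_sym; rewrite /nonneighbour e_sym eq_sym. Qed.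

Lemma mem_argmax (T : eqType) (f : T -> R) (L : seq T) : L != [::] ->
  exists2 m, m \in L & forall x, x \in L -> Rle (f x) (f m).
Proof.
case: L => // x L _; elim: L x => [|y L IH] x.
  by exists x; rewrite ?mem_head // => z; rewrite inE => /eqP->; lra.
have [m mL max_m] := IH y; have [le|lt] := Rle_or_lt (f x) (f m).
  exists m; first by rewrite in_cons mL orbT.
  by move=> z; rewrite in_cons => /predU1P[->|/max_m].
exists x; first exact: mem_head.
by move=> z; rewrite in_cons => /predU1P[->|/max_m]; lra.
Qed.

Section Enclosers.
Variables (T : finType) (e : rel T) (F : T -> frame).
Hypotheses (e_sym : symmetric e) (e_irr : irreflexive e) (layout : frame_layout e F).

Lemma edge_linked x y : e x y -> frame_linked (F x) (F y).
Proof.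
move=> exy; apply: (layout_edge layout) => //.
by apply: contraTneq exy => ->; rewrite e_irr.
Qed.

Lemma inside_nonneighbour v x : frame_inside (F x) (F v) -> nonneighbour e v x.
Proof.
move=> xv; apply/andP; split; first by apply/eqP => xE; rewrite xE in xv; frame_lra.
by apply/negP => /edge_linked; frame_lra.
Qed.

Lemma inside_edge v x y : e x y -> nonneighbour e v y ->
  frame_inside (F x) (F v) -> frame_inside (F y) (F v).
Proof.
move=> exy /andP[yv]; rewrite e_sym => /(layout_nonedge layout yv) sep xv.
have := edge_linked exy; have := layout_ok layout x; have := layout_ok layout y.
have := layout_ok layout v; frame_lra.
Qed.

Lemma inside_connect v x y : connect (nonneighbour_edge e v) x y ->
  frame_inside (F x) (F v) -> frame_inside (F y) (F v).
Proof.
case/connectP=> p path_p ->; elim: p x path_p => //= z p IH x.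
by case/andP=> /and3P[exz _ vz] path_p xv; apply: IH path_p (inside_edge exz vz xv).
Qed.

Lemma encloser_unique u v x y :
    (forall w, {in nonneighbour e w &, forall z t, connect (nonneighbour_edge e w) z t}) ->
    (forall z t, e z t -> exists2 w, nonneighbour e z w & nonneighbour e t w) ->
  frame_inside (F x) (F u) -> frame_inside (F y) (F v) -> u = v.
Proof.
move=> conn common xu yv; apply/eqP/negPn/negP => uv.
have spread w z t : frame_inside (F z) (F w) -> nonneighbour e w t ->
    frame_inside (F t) (F w).
  move=> zw wt; apply: (inside_connect _ zw); apply: conn wt.
  exact: inside_nonneighbour.
have [euv|nuv] := boolP (e u v).
  have [w uw vw] := common u v euv.
  exact: (layout_nest layout uv euv (spread u x w xu uw) (spread v y w yv vw)).
have vu : frame_inside (F v) (F u).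
  by apply: spread xu _; rewrite /nonneighbour nuv eq_sym uv.
have : frame_inside (F u) (F v).
  by apply: spread yv _; rewrite /nonneighbour e_sym nuv uv.
frame_lra.
Qed.

(* The frames of both neighbours of the vertex of maximal [fx1] on the cycle cross its
   left end, and being non-adjacent they are nested. *)
Lemma cycle_encloser (C : seq T) : triangle_free e -> cycle e C -> uniq C -> 2 < size C ->
  exists v x, v \in C /\ frame_inside (F x) (F v).
Proof.
move=> tf cycC uniqC sizeC.
have [m mC max_m] : exists2 m, m \in C & forall x, x \in C -> Rle (fx1 (F x)) (fx1 (F m)).
  by apply: mem_argmax; case: C sizeC {cycC uniqC}.
have [i C' rotC] := rot_to mC.
have memC x : (x \in C) = (x \in m :: C') by rewrite -rotC mem_rot.
move: cycC uniqC sizeC; rewrite -(rot_cycle i) -(rot_uniq i) -(size_rot i) rotC.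
case: C' rotC memC => [//|y C'] _; case/lastP: C' => [//|C' z] memC /=.
rewrite !rcons_path last_rcons mem_rcons !inE !negb_or => /and3P[emy _ ezm].
move=> /and3P[_ /andP[yz _] _] _.
have incoming t : t \in [:: y; z] -> e t m -> frame_arc (F t) (F m).
  move=> tyz /edge_linked[//|arc].
  have /max_m : t \in C.
    by move: tyz; rewrite memC !inE mem_rcons inE => /orP[]->; rewrite ?orbT.
  frame_lra.
have yC : y \in C by rewrite memC !inE eqxx orbT.
have zC : z \in C by rewrite memC !inE mem_rcons mem_head !orbT.
have arc_y : frame_arc (F y) (F m) by apply: incoming; rewrite ?mem_head // e_sym.
have arc_z : frame_arc (F z) (F m) by apply: incoming; rewrite // !inE eqxx orbT.
have nyz : ~~ e y z by apply/negP => eyz; apply: (tf m y z).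
have okm := layout_ok layout m.
have [yz_in|[zy_in|]] := layout_nonedge layout yz nyz; last frame_lra.
- by exists z, y.
- by exists y, z.
Qed.

End Enclosers.

(** * Boxes arranged in three lanes *)

Inductive site := Root | Inner | Outer | Lane of nat & nat.

Section SiteBoxes.
Variables (lane_size : nat -> nat) (cross1 width : nat).

(* The right side of Inner meets the last box of lanes 0 and 2, and box [cross1] of lane 1. *)
Definition crossing (l : nat) : nat := if l == 1 then cross1 else (lane_size l).-1.

Definition leaves_outer (l i : nat) : bool := (l != 2) && (i.+1 == lane_size l).

Definition valid_site (u : site) : bool :=
  if u is Lane l i then (l < 3) && (i < lane_size l) else true.

(* When lane 2 is empty, Inner takes the place of its first box. *)
Definition site_arc (u v : site) : bool :=
  match u, v with
  | Root, Lane _ i => i == 0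
  | Root, Inner => lane_size 2 == 0
  | Inner, Lane l i => i == crossing l
  | Outer, Lane l i => leaves_outer l i
  | Lane l i, Lane l' i' => (l == l') && (i' == i.+1)
  | _, _ => false
  end.

Definition site_linked (u v : site) : bool := site_arc u v || site_arc v u.

(* The lanes are aligned so that the right side of Inner, at [4 * width + 2], lies between
   the left ends of the boxes [crossing l] and [(crossing l).+1] of every lane [l]. *)
Definition lane_left (l i : nat) : nat :=
  if i is 0 then 4 else 4 * (i + width - crossing l).

Arguments lane_left : simpl never.

Definition lane_right (l i : nat) : nat :=
  if leaves_outer l i then (8 * width).+1 else (lane_left l i.+1).+1.

Definition depth (u : site) : nat :=
  match u with
  | Root => if lane_size 2 == 0 then 1 else 3
  | Inner => 2
  | _ => 0
  end.

Definition left_end (u : site) : nat := if u is Lane l i then lane_left l i else depth u.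

Definition right_end (u : site) : nat :=
  match u with
  | Root => 5
  | Inner => 4 * width + 2
  | Outer => 8 * width
  | Lane l i => lane_right l i
  end.

Definition bottom_end (u : site) : nat :=
  if u is Lane l i then 2 * width * l + 4 + i else depth u.

Definition top_end (u : site) : nat :=
  if u is Lane l i then 2 * width * l.+1 + 3 - i else 6 * width + 8 - depth u.

Definition box_arc (u v : site) : bool :=
  [&& left_end u < left_end v < right_end u, right_end u < right_end v,
      bottom_end u < bottom_end v & top_end v < top_end u].

Definition box_inside (u v : site) : bool :=
  [&& left_end v < left_end u, right_end u < right_end v,
      bottom_end v < bottom_end u & top_end u < top_end v].

Definition box_apart (u v : site) : bool :=
  [|| right_end u < left_end v, right_end v < left_end u,
      top_end u < bottom_end v | top_end v < bottom_end u].

Definition box_separate (u v : site) : bool :=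
  [|| box_inside u v, box_inside v u | box_apart u v].

Hypothesis cross1_lt : cross1 < lane_size 1.
Hypothesis lane_size_lt : forall l, l < 3 -> lane_size l < width.

Lemma crossing_lt l i : i < lane_size l -> crossing l < lane_size l.
Proof. by rewrite /crossing; case: eqP => [->|_] //; lia. Qed.

Lemma lane_left0 l : lane_left l 0 = 4. Proof. by []. Qed.

Lemma lane_leftS l i : lane_left l i.+1 = 4 * (i.+1 + width - crossing l).
Proof. by []. Qed.

Lemma lane_left_bounds l i : l < 3 -> i < lane_size l ->
  4 <= lane_left l i < 8 * width - 4.
Proof.
move=> l_lt i_lt; have := lane_size_lt l_lt; have := crossing_lt i_lt.
by case: i i_lt => [|i] i_lt; rewrite ?lane_left0 ?lane_leftS; lia.
Qed.

Lemma lane_left_step l i j : l < 3 -> i < lane_size l -> i < j ->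
  lane_left l i + 4 <= lane_left l j.
Proof.
move=> l_lt i_lt; have := lane_size_lt l_lt; have := crossing_lt i_lt.
by case: j => // j; case: i i_lt => [|i] i_lt; rewrite ?lane_left0 !lane_leftS; lia.
Qed.

Lemma lane_left_crossing l : l < 3 -> lane_left l (crossing l) <= 4 * width.
Proof.
move=> l_lt; have := lane_size_lt l_lt.
by case def_c: (crossing l) => [|c]; rewrite ?lane_left0 ?lane_leftS ?def_c; lia.
Qed.

Lemma lane_right_inner l i : i.+1 < lane_size l -> lane_right l i = (lane_left l i.+1).+1.
Proof. by move=> i_lt; rewrite /lane_right /leaves_outer (ltn_eqF i_lt) andbF. Qed.

Lemma lane_right_gt l i : l < 3 -> i < lane_size l -> lane_left l i.+1 < lane_right l i.
Proof.
move=> l_lt i_lt; rewrite /lane_right; case: ifP => // /andP[_ /eqP last_i].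
have := lane_size_lt l_lt; have := crossing_lt i_lt.
by rewrite lane_leftS; lia.
Qed.

Lemma lane_vertical l i : l < 3 -> i < lane_size l ->
  [&& 4 <= bottom_end (Lane l i), bottom_end (Lane l i) < top_end (Lane l i) &
      top_end (Lane l i) <= 6 * width + 3].
Proof.
by move=> l_lt i_lt; have := lane_size_lt l_lt; case: l l_lt i_lt => [|[|[|//]]] _ i_lt /=; lia.
Qed.

Lemma lane_stacked l i l' i' : l < l' -> l' < 3 -> i < lane_size l -> i' < lane_size l' ->
  top_end (Lane l i) < bottom_end (Lane l' i').
Proof.
move=> ll l_lt i_lt i'_lt; have : 2 * width * l.+1 <= 2 * width * l' by rewrite leq_mul2l ll orbT.
by rewrite /=; lia.
Qed.

Lemma site_box_ok u : valid_site u ->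
  (left_end u < right_end u) && (bottom_end u < top_end u).
Proof.
have width_gt0 := lane_size_lt (isT : 0 < 3).
case: u => [|||l i]; first (by rewrite /=; case: ifP; lia); try by rewrite /=; lia.
move=> /andP[l_lt i_lt]; have := lane_vertical l_lt i_lt; have := lane_right_gt l_lt i_lt.
by have := lane_left_step l_lt i_lt (ltnSn i); rewrite /=; lia.
Qed.

Lemma site_arc_box u v : valid_site u -> valid_site v -> site_arc u v -> box_arc u v.
Proof.
have width_gt0 := lane_size_lt (isT : 0 < 3).
case: u v => [|||l i] [|||l' i'] //; rewrite /box_arc.
- by move=> _ _ /= ->; lia.
- move=> _ /andP[l_lt i_lt] /eqP i0; rewrite i0 in i_lt *.
  have := lane_vertical l_lt i_lt; have := lane_right_gt l_lt i_lt.
  have := lane_left_step l_lt i_lt (ltnSn 0).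
  by rewrite /= lane_left0; case: ifP; lia.
- move=> _ /andP[l_lt i_lt] /eqP ic.
  have := lane_vertical l_lt i_lt; have := lane_right_gt l_lt i_lt.
  have := lane_left_crossing l_lt; have := lane_left_bounds l_lt i_lt.
  by rewrite lane_leftS -ic /=; lia.
- move=> _ /andP[l_lt i_lt] /= arc.
  have := lane_vertical l_lt i_lt; have := lane_left_bounds l_lt i_lt.
  by rewrite /= /lane_right arc; lia.
move=> /andP[l_lt i_lt] /andP[_ i'_lt] /andP[/eqP ll /eqP ii]; subst l' i'.
have := lane_left_step l_lt i_lt (ltnSn i); have := lane_right_gt l_lt i'_lt.
have := lane_left_step l_lt i'_lt (ltnSn i.+1); have := lane_size_lt l_lt.
by rewrite [right_end (Lane l i)]lane_right_inner //=; lia.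
Qed.

Lemma box_separate_sym u v : box_separate u v = box_separate v u.
Proof.
rewrite /box_separate orbCA; congr [|| _, _ | _].
by rewrite /box_apart orbCA; congr [|| _, _ | _]; rewrite orbC.
Qed.

Lemma root_inner_separate : lane_size 2 != 0 -> box_separate Root Inner.
Proof.
have := lane_size_lt (isT : 2 < 3); rewrite /box_separate /box_inside /= => ? /negPf->.
by apply/orP; left; lia.
Qed.

Lemma root_lane_separate l i : l < 3 -> i < lane_size l -> i != 0 ->
  box_separate Root (Lane l i).
Proof.
case: i => // i l_lt i_lt _; have := lane_left_step l_lt (ltn_trans (ltnSn i) i_lt) (ltnSn i).
have := lane_left_bounds l_lt (ltn_trans (ltnSn i) i_lt).
by rewrite /box_separate /box_apart /=; lia.
Qed.

Lemma inner_lane_separate l i : l < 3 -> i < lane_size l -> i != crossing l ->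
  box_separate Inner (Lane l i).
Proof.
move=> l_lt i_lt; have := lane_vertical l_lt i_lt; have := lane_left_bounds l_lt i_lt.
have := lane_size_lt l_lt; have := crossing_lt i_lt; rewrite neq_ltn.
rewrite /box_separate /box_inside /box_apart => cl lw left_i vert_i /orP[ic|ci].
  apply/or3P/Or32; rewrite [right_end (Lane l i)]lane_right_inner ?lane_leftS; last lia.
  by move: vert_i left_i => /=; lia.
apply/or3P/Or33/or4P/Or41; case: i ci {i_lt left_i vert_i} => // i ci.
by rewrite /= lane_leftS; lia.
Qed.

Lemma outer_lane_separate l i : l < 3 -> i < lane_size l ->
  ~~ site_arc Outer (Lane l i) -> box_separate Outer (Lane l i).
Proof.
move=> l_lt i_lt /= /negPf not_last; apply/or3P/Or32.
have := lane_vertical l_lt i_lt; have := lane_left_bounds l_lt i_lt; have := lane_size_lt l_lt.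
have := crossing_lt i_lt; move: not_last.
by rewrite /box_inside /= /lane_right lane_leftS /crossing => ->; case: eqP; lia.
Qed.

Lemma same_lane_separate l i i' : l < 3 -> i' < lane_size l -> i.+1 < i' ->
  box_separate (Lane l i) (Lane l i').
Proof.
move=> l_lt i'_lt ii; apply/or3P/Or33/or4P/Or41.
have i_lt := ltn_trans ii i'_lt; rewrite /= lane_right_inner //.
by have := lane_left_step l_lt i_lt ii; lia.
Qed.

Lemma lanes_separate l i l' i' : valid_site (Lane l i) -> valid_site (Lane l' i') ->
  Lane l i <> Lane l' i' -> ~~ site_linked (Lane l i) (Lane l' i') ->
  box_separate (Lane l i) (Lane l' i').
Proof.
move=> /andP[l_lt i_lt] /andP[l'_lt i'_lt] ne; rewrite /site_linked /= negb_or.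
case: (ltngtP l l') => [ll|ll|ll]; try subst l'.
- by move=> _; apply/or3P/Or33/or4P/Or43/lane_stacked.
- by move=> _; apply/or3P/Or33/or4P/Or44/lane_stacked.
case: (ltngtP i i') ne => [ii|ii|-> //] _; rewrite /= => /andP[not_next not_prev].
- by apply: same_lane_separate; lia.
- by rewrite box_separate_sym; apply: same_lane_separate; lia.
Qed.

Definition site_class (u : site) : nat :=
  match u with Root => 0 | Inner => 1 | Outer => 2 | Lane _ _ => 3 end.

Lemma site_unlinked_separate u v : valid_site u -> valid_site v -> u <> v ->
  ~~ site_linked u v -> box_separate u v.
Proof.
wlog: u v / site_class u <= site_class v.
  move=> ordered; have [uv|/ltnW vu] := leqP (site_class u) (site_class v).
    exact: ordered.
  move=> ? ? uv; rewrite box_separate_sym /site_linked orbC.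
  by apply: ordered => // vuE; apply: uv.
have width_gt0 := lane_size_lt (isT : 0 < 3).
case: u v => [|||l i] [|||l' i'] // _.
- by rewrite /site_linked orbF => _ _ _; apply: root_inner_separate.
- by move=> *; apply/or3P/Or31; rewrite /box_inside /=; case: ifP; lia.
- rewrite /site_linked orbF => _ /andP[l_lt i_lt] _.
  exact: root_lane_separate.
- by move=> *; apply/or3P/Or31; rewrite /box_inside /=; lia.
- rewrite /site_linked orbF => _ /andP[l_lt i_lt] _.
  exact: inner_lane_separate.
- rewrite /site_linked orbF => _ /andP[l_lt i_lt] _.
  exact: outer_lane_separate.
- exact: lanes_separate.
Qed.

Lemma lane_not_inside l i i' : l < 3 -> i < lane_size l -> i' < lane_size l ->
  ~~ box_inside (Lane l i) (Lane l i').
Proof.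
move=> l_lt i_lt i'_lt; apply/negP => /and4P[/= left_lt right_lt _ _].
have [ii|ii|ii] := ltngtP i i'; last by rewrite ii ltnn in left_lt.
  by have := lane_left_step l_lt i_lt ii; lia.
have next_lt : i'.+1 < lane_size l by apply: leq_ltn_trans ii i_lt.
have := lane_right_gt l_lt i_lt; move: right_lt; rewrite (lane_right_inner next_lt).
have := lane_left_step l_lt i_lt (ltnSn i).
have [->|lt] := eqVneq i i'.+1; first by lia.
by have := @lane_left_step l i'.+1 i l_lt next_lt; lia.
Qed.

Lemma box_inside_container u v : valid_site u -> valid_site v -> box_inside u v ->
  v = Inner \/ v = Outer.
Proof.
move=> vu; case: v => [|||l' i'] vv; [|by left|by right|]; case/and4P.
  move=> _ right_lt _ _; move: right_lt; have := lane_size_lt (isT : 0 < 3).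
  case: u vu => [|||l i] /=; try lia; move=> /andP[l_lt i_lt].
  by have := lane_right_gt l_lt i_lt; have := lane_left_step l_lt i_lt (ltnSn i); lia.
move: vv => /andP[l'_lt i'_lt]; have vert := lane_vertical l'_lt i'_lt.
case: u vu => [|||l i] vu; try by move: vert => /=; try case: ifP; lia.
case/andP: vu => l_lt i_lt left_lt right_lt bottom_lt top_lt.
have vert' := lane_vertical l_lt i_lt; case: (ltngtP l l') => [ll|ll|ll].
- by have := lane_stacked ll l'_lt i_lt i'_lt; lia.
- by have := lane_stacked ll l_lt i'_lt i_lt; lia.
- subst l'; have /negP[] := lane_not_inside l_lt i_lt i'_lt.
  exact/and4P.
Qed.

Definition site_frame (u : site) : frame :=
  Frame (INR (left_end u)) (INR (right_end u)) (INR (bottom_end u)) (INR (top_end u)).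

Lemma site_frame_arc u v : box_arc u v -> frame_arc (site_frame u) (site_frame v).
Proof. by case/and4P=> /andP[? ?] ? ? ?; do !split; apply/lt_INR/ltP. Qed.

Lemma site_frame_insideP u v :
  reflect (frame_inside (site_frame u) (site_frame v)) (box_inside u v).
Proof.
apply: (iffP and4P) => [[? ? ? ?]|[? [? [? ?]]]].
  by do !split; apply/lt_INR/ltP.
by split; apply/ltP/INR_lt.
Qed.

Lemma site_frame_separate u v : box_separate u v ->
  frame_separate (site_frame u) (site_frame v).
Proof.
case/or3P=> [/site_frame_insideP|/site_frame_insideP|]; [by left|by right; left|].
by case/or4P=> /ltP/lt_INR ?; right; right; rewrite /frame_apart /=; tauto.
Qed.

Lemma restricted_frame_graph_of_sites (T : finType) (e : rel T) (code : T -> site) :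
    injective code -> (forall x, valid_site (code x)) ->
    (forall x y, e x y = site_linked (code x) (code y)) ->
  restricted_frame_graph e.
Proof.
move=> code_inj valid_code eE.
apply: (@layout_restricted_frame_graph _ _ (site_frame \o code)); split=> [v|u v _|u v uv|].
- by have /andP[/ltP/lt_INR ? /ltP/lt_INR] := site_box_ok (valid_code v).
- by rewrite eE => /orP[] arc; [left|right]; apply/site_frame_arc/site_arc_box.
- rewrite eE => nlink; apply/site_frame_separate/site_unlinked_separate => //.
  by move/code_inj/eqP; rewrite (negPf uv).
move=> u v w _ + /site_frame_insideP wu /site_frame_insideP wv; rewrite eE.
by case: (box_inside_container _ _ wu) => // ->; case: (box_inside_container _ _ wv) => // ->.
Qed.

End SiteBoxes.

(** * Consecutive elements of a sequence *)

Section Consecutive.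
Variable T : eqType.
Implicit Types (x y u v : T) (L : seq T).

Lemma consecP L x y : consec L x y <-> exists L1 L2, L = L1 ++ x :: y :: L2.
Proof.
split=> [[k [lt_k [hx hy]]]|[L1 [L2 ->]]].
  exists (take k L), (drop k.+2 L).
  by rewrite -[in LHS](cat_take_drop k L) (drop_nth x (ltnW lt_k)) (drop_nth x lt_k) hx hy.
exists (size L1); rewrite size_cat !nth_cat ltnn subnn subSnn.
by rewrite (ltn_geF (leqnSn _)) /=; split=> //; lia.
Qed.

Lemma consec_nth x0 L x y :
  consec L x y <-> exists i, [/\ i.+1 < size L, x = nth x0 L i & y = nth x0 L i.+1].
Proof.
split=> [[i [lt_i [<- <-]]]|[i [lt_i -> ->]]]; exists i.
  by split=> //; apply: set_nth_default; rewrite // ltnW.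
by split=> //; split; apply: set_nth_default; rewrite // ltnW.
Qed.

Lemma consec_rev L x y : consec (rev L) x y <-> consec L y x.
Proof.
rewrite !consecP; split=> -[L1 [L2 LE]]; exists (rev L2), (rev L1).
  by rewrite -[L]revK LE rev_cat !rev_cons -!cats1 -!catA.
by rewrite LE rev_cat !rev_cons -!cats1 -!catA.
Qed.

Lemma consec_mem L x y : consec L x y -> x \in L /\ y \in L.
Proof. by move/consecP=> [L1 [L2 ->]]; rewrite !mem_cat !inE !eqxx !orbT. Qed.

Lemma consec_index L x y : uniq L -> consec L x y -> index y L = (index x L).+1.
Proof.
move=> uL [k [lt_k [hx hy]]].
by rewrite -[in LHS]hy index_uniq // -[in RHS]hx index_uniq // ltnW.
Qed.

Lemma consec_seq1 x u v : ~ consec [:: x] u v.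
Proof. by case=> k []. Qed.

Lemma consec_cons x y L u v :
  consec [:: x, y & L] u v <-> u = x /\ v = y \/ consec (y :: L) u v.
Proof.
rewrite !(consec_nth x); split=> [[[|i] [lt_i -> ->]]|[[-> ->]|[i [lt_i -> ->]]]].
- by left.
- by right; exists i.
- by exists 0.
- by exists i.+1.
Qed.

Lemma consec_cat L1 x L2 u v :
  consec (L1 ++ x :: L2) u v <-> consec (rcons L1 x) u v \/ consec (x :: L2) u v.
Proof.
elim: L1 => [|y [|z L1] IH] /=; first by split=> [|[/consec_seq1|]]; [right| |].
  by rewrite !consec_cons; split=> [|[[|/consec_seq1]|]]; tauto.
by rewrite !consec_cons IH; tauto.
Qed.

Lemma consec_rcons x L z u v :
  consec (x :: rcons L z) u v <-> consec (x :: L) u v \/ u = last x L /\ v = z.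
Proof.
rewrite -rcons_cons lastI -cats1 cat_rcons consec_cat -lastI consec_cons.
by split=> [[|[|/consec_seq1]]|[|]]; tauto.
Qed.

Lemma path_consecP (r : rel T) x L :
  reflect (forall u v, consec (x :: L) u v -> r u v) (path r x L).
Proof.
apply: (iffP (pathP x)) => [r_nth u v|r_consec i lt_i].
  by case/(consec_nth x)=> i [lt_i -> ->]; apply: r_nth.
by apply: r_consec; apply/(consec_nth x); exists i.
Qed.

End Consecutive.

(** * Graphs made of three lanes *)

Section LaneGraph.
Variables (T : finType) (e : rel T) (root inner outer : T) (lane : nat -> seq T) (cross1 : nat).

Definition lane_vertices : seq T := [:: root; inner; outer] ++ lane 0 ++ lane 1 ++ lane 2.

Definition lane_edge (x y : T) : Prop :=
  [\/ exists2 l, l < 3 & consec (root :: lane l) x y,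
      x = inner /\ y \in [:: last root (lane 0); nth root (lane 1) cross1; last root (lane 2)] |
      x = outer /\ y \in [:: last root (lane 0); last root (lane 1)]].

Definition vertex_at (u : site) : T :=
  match u with
  | Root => root
  | Inner => inner
  | Outer => outer
  | Lane l i => nth root (lane l) i
  end.

Definition site_index (u : site) : nat :=
  match u with
  | Root => 0
  | Inner => 1
  | Outer => 2
  | Lane 0 i => 3 + i
  | Lane 1 i => 3 + size (lane 0) + i
  | Lane _ i => 3 + size (lane 0) + size (lane 1) + i
  end.

Let lane_size (l : nat) : nat := size (lane l).

Hypotheses (vertices_uniq : uniq lane_vertices) (vertices_cover : forall x, x \in lane_vertices).
Hypotheses (lane0_gt0 : 0 < size (lane 0)) (cross1_lt : cross1 < size (lane 1)).

Lemma vertex_atE u : valid_site lane_size u ->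
  vertex_at u = nth root lane_vertices (site_index u).
Proof.
rewrite /lane_vertices; case: u => // -[|[|[|//]]] i /= i_lt; rewrite ?addSn !nth_cat.
- by rewrite i_lt.
- by rewrite addKn ltnNge leq_addr i_lt.
- by rewrite -addnA ltnNge leq_addr /= addKn ltnNge leq_addr addKn.
Qed.

Lemma site_index_lt u : valid_site lane_size u -> site_index u < size lane_vertices.
Proof.
by rewrite /lane_size /lane_vertices !size_cat; case: u => [|||[|[|[|//]]] i] /=; lia.
Qed.

Lemma site_index_inj u v : valid_site lane_size u -> valid_site lane_size v ->
  site_index u = site_index v -> u = v.
Proof.
rewrite /lane_size; case: u v => [|||[|[|[|//]]] i] [|||[|[|[|//]]] j] //= iV jV; try lia;
  by move=> ij; congr Lane; lia.
Qed.

Lemma vertex_at_inj u v : valid_site lane_size u -> valid_site lane_size v ->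
  vertex_at u = vertex_at v -> u = v.
Proof.
move=> uV vV; rewrite !vertex_atE // => /eqP.
by rewrite nth_uniq ?site_index_lt // => /eqP/site_index_inj; apply.
Qed.

Lemma vertex_at_surj x : exists2 u, valid_site lane_size u & vertex_at u = x.
Proof.
have in_lane l : l < 3 -> x \in lane l ->
    exists2 u, valid_site lane_size u & vertex_at u = x.
  by move=> l_lt /(nthP root)[i i_lt xE]; exists (Lane l i); rewrite //= l_lt.
have := vertices_cover x; rewrite !mem_cat !inE => /or4P[]; [|exact: in_lane..].
by case/or3P=> /eqP->; [exists Root|exists Inner|exists Outer].
Qed.

Lemma site_arc_lane_edge u v : valid_site lane_size u -> valid_site lane_size v ->
  site_arc lane_size cross1 u v ->
  lane_edge (vertex_at u) (vertex_at v) \/ lane_edge (vertex_at v) (vertex_at u).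
Proof.
case: u v => [|||l i] [|||l' i'] //=; rewrite /lane_size.
- by move=> _ _ /eqP/size0nil lane2; right; constructor 2; rewrite lane2 !inE eqxx !orbT.
- move=> _ /andP[l_lt i_lt] /eqP i0; left; constructor 1; exists l' => //.
  by apply/(consec_nth root); exists 0; rewrite i0 in i_lt *.
- move=> _ /andP[l_lt i_lt] /eqP->; left; constructor 2; split=> //.
  rewrite !inE /crossing; case: l' l_lt i_lt => [|[|[|//]]] _ _ /=.
  + by rewrite nth_last eqxx.
  + by rewrite eqxx orbT.
  + by rewrite nth_last eqxx !orbT.
- move=> _ /andP[l_lt i_lt] /andP[l2 /eqP last_i]; left; constructor 3; split=> //.
  have -> : nth root (lane l') i' = last root (lane l') by rewrite -nth_last -last_i.
  by case: l' l_lt l2 {i_lt last_i} => [|[|[|]]] // _ _; rewrite !inE eqxx ?orbT.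
- move=> /andP[l_lt i_lt] /andP[_ i_lt'] /andP[/eqP ll /eqP ii]; subst l' i'.
  left; constructor 1; exists l => //.
  by apply/(consec_nth root); exists i.+1.
Qed.

Lemma lane_edge_site_linked x y : lane_edge x y ->
  exists u v, [/\ valid_site lane_size u, valid_site lane_size v,
    vertex_at u = x, vertex_at v = y & site_linked lane_size cross1 u v].
Proof.
have lane_end l : l < 3 -> 0 < size (lane l) ->
    exists i, [/\ valid_site lane_size (Lane l i), i.+1 = lane_size l &
                  vertex_at (Lane l i) = last root (lane l)].
  move=> l_lt lane_gt0; exists (size (lane l)).-1.
  by rewrite /= nth_last /lane_size prednK // leqnn l_lt.
rewrite /lane_edge; have [i0 [valid0 end0 <-]] := lane_end 0 isT lane0_gt0.
have [i1 [valid1 end1 <-]] := lane_end 1 isT (leq_ltn_trans (leq0n cross1) cross1_lt).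
case=> [[l l_lt /(consec_nth root)[[|i] [i_lt -> ->]]]|[->]|[->]].
- by exists Root, (Lane l 0); rewrite /= l_lt.
- exists (Lane l i), (Lane l i.+1); rewrite /site_linked /= l_lt !eqxx.
  by split=> //; apply: ltnW.
- rewrite !inE => /or3P[]/eqP->.
  + by exists Inner, (Lane 0 i0); rewrite /site_linked /= /crossing -end0 eqxx.
  + by exists Inner, (Lane 1 cross1); rewrite /site_linked /= eqxx.
  + have [/size0nil lane2|lane2] := posnP (size (lane 2)).
      by exists Inner, Root; rewrite /site_linked /= /lane_size lane2.
    have [i2 [valid2 end2 <-]] := lane_end 2 isT lane2.
    by exists Inner, (Lane 2 i2); rewrite /site_linked /= /crossing -end2 eqxx.
- rewrite !inE => /orP[]/eqP->.
  + by exists Outer, (Lane 0 i0); rewrite /site_linked /= /leaves_outer end0 eqxx.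
  + by exists Outer, (Lane 1 i1); rewrite /site_linked /= /leaves_outer end1 eqxx.
Qed.

Lemma restricted_frame_graph_of_lanes :
  (forall x y, e x y <-> lane_edge x y \/ lane_edge y x) -> restricted_frame_graph e.
Proof.
move=> edgeP.
have [code valid_code codeK] := fin_all_exists2 vertex_at_surj.
pose width := (lane_size 0 + lane_size 1 + lane_size 2).+1.
apply: (@restricted_frame_graph_of_sites lane_size cross1 width cross1_lt _ _ _ code) => //.
- by move=> [|[|[|//]]] _; rewrite /width; lia.
- exact: can_inj codeK.
move=> x y; apply/idP/idP => [/edgeP|].
  have linked x' y' : lane_edge x' y' -> site_linked lane_size cross1 (code x') (code y').
    case/lane_edge_site_linked=> u [v [uV vV]].
    rewrite -{1}[x']codeK -{1}[y']codeK.
    by move=> /vertex_at_inj<- // /vertex_at_inj<-.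
  by case=> /linked //; rewrite /site_linked orbC.
rewrite /site_linked => /orP[] /site_arc_lane_edge; rewrite !codeK => adj; apply/edgeP;
  have := adj (valid_code _) (valid_code _); tauto.
Qed.

End LaneGraph.

(** * Subdivisions of K4 *)

Lemma uniq_size_mem (I : finType) (s : seq I) : uniq s -> size s = #|I| -> forall x, x \in s.
Proof.
move=> us sz x; have [||_ ->] := @uniq_min_size _ s (enum I) us; last by rewrite mem_enum.
- by move=> y; rewrite mem_enum.
- by rewrite sz cardE.
Qed.

Lemma uniq_extend (I : finType) (s : seq I) : uniq s ->
  exists2 t, uniq (s ++ t) & size (s ++ t) = #|I|.
Proof.
move=> us; pose t := [seq x <- enum I | x \notin s].
have ut : uniq (s ++ t).
  rewrite cat_uniq us filter_uniq ?enum_uniq // andbT -all_predC.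
  by apply/allP => x; rewrite mem_filter => /andP[].
exists t => //; rewrite -(card_uniqP ut); apply: eq_card => x.
by rewrite mem_cat mem_filter mem_enum inE andbT orbN.
Qed.

Lemma mem_ord4 (i j k l : 'I_4) : uniq [:: i; j; k; l] -> forall p, p \in [:: i; j; k; l].
Proof. by move=> u; apply: uniq_size_mem; rewrite ?card_ord. Qed.

Lemma ord4_neq (i : 'I_4) : exists j, i != j.
Proof. by have [->|i_neq0] := eqVneq i ord0; [exists ord_max|exists ord0]. Qed.

Lemma ord4_pair_extend (i j : 'I_4) : i != j -> exists k l, uniq [:: i; j; k; l].
Proof.
move=> ij; have [|t] := @uniq_extend _ [:: i; j]; first by rewrite /= inE ij.
by rewrite card_ord; case: t => [|k [|l []]] // u _; exists k, l.
Qed.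

Definition K4_edges (I : eqType) (i j k l : I) : seq (I * I) :=
  [:: (i, j); (i, k); (i, l); (j, k); (j, l); (k, l)].

Lemma uniq4E (I : eqType) (i j k l : I) : uniq [:: i; j; k; l] =
  [&& i != j, i != k, i != l, j != k, j != l & k != l].
Proof. by rewrite /= !inE !negb_or andbT -!andbA. Qed.

Lemma neq_eqF (I : eqType) (x y : I) : x != y -> (x == y = false) * (y == x = false).
Proof. by rewrite [y == x]eq_sym => /negPf->. Qed.

Lemma K4_edges_neq (I : eqType) (i j k l : I) p :
  uniq [:: i; j; k; l] -> p \in K4_edges i j k l -> p.1 != p.2.
Proof.
rewrite uniq4E => /and5P[ij ik il jk /andP[jl kl]]; rewrite !inE.
by do !case/predU1P=> [->|] //; move/eqP->.
Qed.

Lemma K4_edges_uniq (I : eqType) (i j k l : I) : uniq [:: i; j; k; l] -> uniq (K4_edges i j k l).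
Proof.
rewrite uniq4E => /and5P[ij ik il jk /andP[jl kl]].
by rewrite /= !inE !xpair_eqE !negb_or !negb_and ?ij ?ik ?il ?jk ?jl ?kl ?orbT.
Qed.

Lemma K4_edges_orientation (I : eqType) (i j k l : I) : uniq [:: i; j; k; l] ->
  {in [:: i; j; k; l] &, forall p q, p != q ->
    ((p, q) \in K4_edges i j k l) (+) ((q, p) \in K4_edges i j k l)}.
Proof.
rewrite uniq4E => /and5P[ij ik il jk /andP[jl kl]] p q; rewrite !inE !xpair_eqE.
by case/or4P=> /eqP-> /or4P[]/eqP->;
  rewrite !(eqxx, neq_eqF ij, neq_eqF ik, neq_eqF il, neq_eqF jk, neq_eqF jl, neq_eqF kl).
Qed.

(* [s i j] is the path only for [i < j]; [interior s i j] reads it from [i] to [j]. *)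
Definition interior (T : finType) (s : 'I_4 -> 'I_4 -> seq T) (i j : 'I_4) : seq T :=
  if (i < j)%N then s i j else rev (s j i).

Section K4Subdivision.
Variables (T : finType) (e : rel T) (b : 'I_4 -> T) (s : 'I_4 -> 'I_4 -> seq T).
Hypothesis subK4 : K4_subdivision_witness e b s.
Notation mid := (interior s).
Notation P := (K4path b (interior s)).

Lemma branch_inj : injective b. Proof. by case: subK4. Qed.

Lemma interior_lt (i j : 'I_4) : i < j -> mid i j = s i j.
Proof. by rewrite /interior => ->. Qed.

Lemma interior_rev (i j : 'I_4) : i != j -> mid j i = rev (mid i j).
Proof. by rewrite /interior -val_eqE /=; case: ltngtP => // _ _; rewrite revK. Qed.

Lemma subdividedE (i j : 'I_4) : i != j -> subdivided s i j = (mid i j != [::]).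
Proof.
rewrite /subdivided /interior -val_eqE /=; case: ltngtP => // _ _.
by rewrite -!size_eq0 size_rev.
Qed.

Lemma K4path_rev (i j : 'I_4) : i != j -> P j i = rev (P i j).
Proof. by move=> ij; rewrite /K4path (interior_rev ij) rev_cons rev_rcons. Qed.

Lemma branch_notin_interior k i j : i != j -> b k \notin mid i j.
Proof.
case: subK4 => _ [_ [notin _]]; rewrite /interior -val_eqE /=.
by case: ltngtP => // lt _; rewrite ?mem_rev notin.
Qed.

Lemma interior_uniq i j : i != j -> uniq (mid i j).
Proof.
case: subK4 => _ [us _]; rewrite /interior -val_eqE /=.
by case: ltngtP => // lt _; rewrite ?rev_uniq us.
Qed.

Lemma interior_disjoint i j k l x : i != j -> k != l -> x \in mid i j -> x \in mid k l ->
  (k, l) = (i, j) \/ (k, l) = (j, i).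
Proof.
case: subK4 => _ [_ [_ [disj _]]].
have meet_eq (i' j' k' l' : 'I_4) : i' < j' -> k' < l' -> x \in s i' j' -> x \in s k' l' ->
    (k', l') = (i', j').
  move=> ij kl xi xk; apply/eqP; apply: contraTT xk => ne.
  by apply: disj xi => // E; rewrite E eqxx in ne.
rewrite /interior -!val_eqE /=; case: ltngtP => // ij _; case: ltngtP => // kl _.
all: rewrite ?mem_rev => xi xk; have [? ?] := meet_eq _ _ _ _ ij kl xi xk; subst.
all: by auto.
Qed.

Lemma K4path_uniq i j : i != j -> uniq (P i j).
Proof.
move=> ij; rewrite /K4path cons_uniq rcons_uniq mem_rcons inE negb_or.
by rewrite !branch_notin_interior // interior_uniq // (inj_eq branch_inj) ij.
Qed.

Lemma mem_K4path x i j : (x \in P i j) = [|| x == b i, x == b j | x \in mid i j].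
Proof. by rewrite /K4path inE mem_rcons inE. Qed.

Lemma mem_K4path_swap i j p q : p \in [:: i; j] -> q \in [:: i; j] -> p != q ->
  P p q =i P i j.
Proof.
rewrite !inE => /orP[]/eqP-> /orP[]/eqP-> pq x; rewrite ?eqxx // in pq *.
by rewrite K4path_rev ?mem_rev // eq_sym.
Qed.

Lemma interior_K4path x i j : x \in mid i j -> x \in P i j.
Proof. by rewrite mem_K4path => ->; rewrite !orbT. Qed.

Lemma branch_in_K4path k i j : i != j -> (b k \in P i j) = (k \in [:: i; j]).
Proof.
move=> ij; rewrite mem_K4path !(inj_eq branch_inj) (negPf (branch_notin_interior k ij)).
by rewrite orbF !inE.
Qed.

Lemma K4path_endpoint x i j : x \in P i j -> x \notin mid i j ->
  exists2 p, p \in [:: i; j] & x = b p.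
Proof.
rewrite mem_K4path => /or3P[/eqP->|/eqP->|->] // _; first by exists i; rewrite ?mem_head.
by exists j; rewrite // !inE eqxx orbT.
Qed.

Lemma interior_in_K4path i j k l x : i != j -> k != l -> x \in mid i j -> x \in P k l ->
  (k, l) = (i, j) \/ (k, l) = (j, i).
Proof.
move=> ij kl xi; rewrite mem_K4path => /or3P[/eqP xE|/eqP xE|]; last exact: interior_disjoint.
- by move: xi; rewrite xE (negPf (branch_notin_interior _ ij)).
- by move: xi; rewrite xE (negPf (branch_notin_interior _ ij)).
Qed.

Lemma K4path_cover x : exists i j, i != j /\ x \in P i j.
Proof.
case: subK4 => _ [_ [_ [_ [cover _]]]]; case: (cover x) => [[k ->]|[i [j [ij xs]]]].
  have [j kj] := ord4_neq k.
  by exists k, j; rewrite mem_K4path eqxx.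
exists i, j; rewrite interior_K4path ?interior_lt //; split=> //.
by rewrite -val_eqE neq_ltn /= ij.
Qed.

Lemma K4_edgeP x y : e x y <-> exists i j, i != j /\ consec (P i j) x y.
Proof.
have PE (i j : 'I_4) : i < j -> K4path b s i j = P i j.
  by move=> ij; rewrite /K4path interior_lt.
case: subK4 => _ [_ [_ [_ [_ ->]]]]; split=> [[i [j [ij]]]|[i [j [ij xy]]]].
  have ne : i != j by rewrite -val_eqE neq_ltn /= ij.
  rewrite PE // => -[xy|yx]; first by exists i, j.
  by exists j, i; rewrite eq_sym ne K4path_rev // consec_rev.
have := ij; rewrite -val_eqE neq_ltn /= => /orP[lt|lt].
  by exists i, j; rewrite PE //; auto.
exists j, i; rewrite PE //; split=> //; right.
by rewrite K4path_rev // consec_rev.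
Qed.

Lemma K4_edge_sym : symmetric e.
Proof.
suff sub x y : e x y -> e y x by move=> x y; apply/idP/idP; apply: sub.
move=> /K4_edgeP[i [j [ij xy]]]; apply/K4_edgeP; exists j, i.
by rewrite eq_sym K4path_rev // consec_rev.
Qed.

Lemma K4_edge_irrefl : irreflexive e.
Proof.
move=> x; apply/negP => /K4_edgeP[i [j [ij xx]]].
by have := consec_index (K4path_uniq ij) xx; lia.
Qed.

Lemma K4path_path i j : i != j -> path e (b i) (rcons (mid i j) (b j)).
Proof. by move=> ij; apply/path_consecP => x y xy; apply/K4_edgeP; exists i, j. Qed.

Lemma interior_edge i j x y : i != j -> x \in mid i j -> e x y -> y \in P i j.
Proof.
move=> ij xs /K4_edgeP[k [l [kl xy]]]; have [xk yk] := consec_mem xy.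
case: (interior_in_K4path ij kl xs xk) => -[? ?]; subst k l => //.
by rewrite K4path_rev ?mem_rev // eq_sym.
Qed.

Lemma K4_edge_consec i j x y : i != j -> x \in P i j -> y \in P i j -> e x y ->
  consec (P i j) x y \/ consec (P i j) y x.
Proof.
move=> ij xi yi exy; have /K4_edgeP[k [l [kl xy]]] := exy; have [xk yk] := consec_mem xy.
suff : (k, l) = (i, j) \/ (k, l) = (j, i).
  case=> -[? ?]; subst k l; first by left.
  by right; rewrite -consec_rev -K4path_rev // eq_sym.
have [xs|nxs] := boolP (x \in mid i j); first exact: interior_in_K4path xs xk.
have [ys|nys] := boolP (y \in mid i j); first exact: interior_in_K4path ys yk.
have [p pij xE] := K4path_endpoint xi nxs; have [q qij yE] := K4path_endpoint yi nys.
have pq : p != q by apply: contraTneq exy => pq; rewrite xE yE pq K4_edge_irrefl.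
move: xk yk; rewrite xE yE !branch_in_K4path // => pkl qkl.
move: pq kl; move: pij qij pkl qkl; rewrite !inE.
by do 4![case/orP=> /eqP ?]; subst; rewrite ?eqxx; auto.
Qed.

Lemma K4path_nonneighbour i j L1 x L2 y z : i != j -> P i j = L1 ++ x :: L2 ->
  y \in L1 -> z \in L2 -> nonneighbour e y z.
Proof.
move=> ij PE yL zL; have uP := K4path_uniq ij.
have [yP zP] : y \in P i j /\ z \in P i j by rewrite PE !mem_cat !in_cons yL zL !orbT.
have index_y : index y (P i j) < size L1 by rewrite PE index_cat yL index_mem.
have index_z : size L1 < index z (P i j).
  move: uP; rewrite PE cat_uniq /= => /and3P[_ /norP[_ /hasPn notL1] /andP[xL2 _]].
  rewrite index_cat (negPf (notL1 _ zL)) /= ifN ?addnS ?ltnS ?leq_addr //.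
  by apply: contraNneq xL2 => ->.
apply/andP; split; first by apply: contraTneq index_z => ->; rewrite -leqNgt ltnW.
by apply/negP => /(K4_edge_consec ij yP zP)[] /(consec_index uP); lia.
Qed.

Lemma branch_edge i j : i != j -> e (b i) (b j) = (mid i j == [::]).
Proof.
move=> ij; case midE: (mid i j) => [|x L].
  by apply/K4_edgeP; exists i, j; rewrite /K4path midE consec_cons; auto.
have /andP[_ /negbTE //] : nonneighbour e (b i) (b j).
apply: (@K4path_nonneighbour i j [:: b i] x (rcons L (b j))) => //.
- by rewrite /K4path midE.
- by rewrite mem_head.
- by rewrite mem_rcons mem_head.
Qed.

Definition K4_vertices (i j k l : 'I_4) : seq T :=
  [seq b p | p <- [:: i; j; k; l]] ++ [seq x | p <- K4_edges i j k l, x <- mid p.1 p.2].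

Lemma K4_vertices_uniq i j k l : uniq [:: i; j; k; l] -> uniq (K4_vertices i j k l).
Proof.
move=> u; have neq p := @K4_edges_neq _ i j k l p u.
have cover := mem_ord4 u.
rewrite cat_uniq (map_inj_uniq branch_inj) u andTb; apply/andP; split.
  apply/hasPn => _ /allpairsPdep[p [x [pE xp ->]]]; apply/mapP => -[q _ xE].
  by rewrite xE (negPf (branch_notin_interior _ (neq _ pE))) in xp.
apply: allpairs_uniq_dep => [|p /neq/interior_uniq //|]; first exact: K4_edges_uniq.
move=> _ _ /allpairsPdep[p [x [pE xp ->]]] /allpairsPdep[q [y [qE yq ->]]] /= xy.
rewrite -{}xy in yq *; suff -> : q = p by [].
have := interior_disjoint (neq _ pE) (neq _ qE) xp yq; rewrite -!surjective_pairing.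
case=> // qp.
have := K4_edges_orientation u (cover p.1) (cover p.2) (neq _ pE).
by rewrite -surjective_pairing -qp pE qE.
Qed.

Lemma exists_in_K4_edges i j k l p q (R : 'I_4 -> 'I_4 -> Prop) : uniq [:: i; j; k; l] ->
  (forall m n, m != n -> R m n -> R n m) -> p != q -> R p q ->
  exists2 r, r \in K4_edges i j k l & R r.1 r.2.
Proof.
move=> u R_sym pq Rpq; have cover := mem_ord4 u.
have := K4_edges_orientation u (cover p) (cover q) pq.
case pqE: ((p, q) \in _); first by exists (p, q).
by move=> /= qpE; exists (q, p) => //=; apply: R_sym.
Qed.

Lemma K4_vertices_cover i j k l x : uniq [:: i; j; k; l] -> x \in K4_vertices i j k l.
Proof.
move=> u; have [p [q [pq]]] := K4path_cover x.
case/(@exists_in_K4_edges i j k l p q (fun m n => x \in P m n) u _ pq).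
  by move=> m n mn; rewrite (K4path_rev mn) mem_rev.
move=> r rE; rewrite mem_K4path mem_cat => /or3P[/eqP->|/eqP->|xr].
- by rewrite map_f // mem_ord4.
- by rewrite map_f // mem_ord4.
- by apply/orP; right; apply/allpairsPdep; exists r, x.
Qed.

Lemma K4_edge_orientedP i j k l x y : uniq [:: i; j; k; l] ->
  e x y <-> exists2 r, r \in K4_edges i j k l &
    consec (P r.1 r.2) x y \/ consec (P r.1 r.2) y x.
Proof.
move=> u; split=> [/K4_edgeP[p [q [pq xy]]]|[r /(K4_edges_neq u) rE]].
  pose joins m n := consec (P m n) x y \/ consec (P m n) y x.
  apply: (@exists_in_K4_edges i j k l p q joins u _ pq).
    by move=> m n mn; rewrite /joins (K4path_rev mn) !consec_rev; tauto.
  by left.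
by case=> xy; [|rewrite K4_edge_sym]; apply/K4_edgeP; exists r.1, r.2.
Qed.

Definition K4cycle (i j k : 'I_4) : seq T :=
  b i :: mid i j ++ b j :: mid j k ++ b k :: mid k i.

Lemma K4cycle_cycle i j k : i != j -> j != k -> k != i -> cycle e (K4cycle i j k).
Proof.
move=> ij jk ki; rewrite /= !(rcons_cat, rcons_cons) -!cat_rcons !cat_path !last_rcons.
by rewrite !K4path_path.
Qed.

Lemma mem_K4cycle x i j k :
  (x \in K4cycle i j k) = [|| x \in P i j, x \in P j k | x \in P k i].
Proof.
rewrite !mem_K4path !(inE, mem_cat).
by do !case: (_ == _); do !case: (_ \in _).
Qed.

Lemma K4cycle_uniq i j k l : uniq [:: i; j; k; l] -> uniq (K4cycle i j k).
Proof.
move=> u; have := K4_vertices_uniq u; move: u; rewrite uniq4E => /and3P[_ ik _].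
have/perm_uniq-> : perm_eq (K4_vertices i j k l)
    (K4cycle i j k ++ b l :: mid i l ++ mid j l ++ mid k l).
  apply/permP => p; rewrite /K4_vertices /K4cycle /= (interior_rev ik) !map_id.
  by do !rewrite !(count_cat, count_rev) /=; lia.
by rewrite cat_uniq => /and3P[].
Qed.

Section BranchMatching.
Hypothesis branch_matching : forall i j k, e (b i) (b j) -> e (b i) (b k) -> j = k.

Lemma common_branch_neighbour i j v : i != j -> e v (b i) -> e v (b j) -> v \in P i j.
Proof.
move=> ij vi vj; have [k [l [kl vP]]] := K4path_cover v.
have [vkl|nvkl] := boolP (v \in mid k l); last first.
  have [p _ vE] := K4path_endpoint vP nvkl; rewrite vE in vi vj.
  by case/eqP: ij; apply: branch_matching vi vj.
have := interior_edge kl vkl vi; have := interior_edge kl vkl vj.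
rewrite !branch_in_K4path // => jkl ikl.
by rewrite (mem_K4path_swap ikl jkl).
Qed.

(* The closed neighbourhood of [v] meets every path of the subdivision in an interval. *)
Lemma nonneighbour_between i j v L1 x L2 : i != j -> P i j = L1 ++ x :: L2 ->
  nonneighbour e v x -> all (nonneighbour e v) L1 \/ all (nonneighbour e v) L2.
Proof.
move=> ij PE vx; have [|/allPn[y yL1 vy]] := boolP (all _ L1); first by left.
have [|/allPn[z zL2 vz]] := boolP (all _ L2); first by right.
have far := K4path_nonneighbour ij PE; exfalso.
have memP w : w \in P i j = [|| w \in L1, w == x | w \in L2] by rewrite PE mem_cat in_cons.
have [|vP] := boolP (v \in P i j).
  rewrite memP => /or3P[vL1|/eqP vE|vL2]; first by rewrite far in vz.
    by rewrite vE /nonneighbour eqxx in vx.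
  by rewrite (nonneighbour_sym _ _ K4_edge_sym) far in vy.
have endpoint w : w \in P i j -> ~~ nonneighbour e v w ->
    exists2 p, p \in [:: i; j] & w = b p /\ e v w.
  move=> wP; rewrite /nonneighbour negb_and !negbK => vw.
  have {}vw : e v w by case/predU1P: vw => // wE; rewrite -wE wP in vP.
  have [] := K4path_endpoint wP; last by move=> p pij wE; exists p.
  by apply: contraNN vP => wij; apply: interior_edge ij wij _; rewrite K4_edge_sym.
have [||p pij [yE vyE]] := endpoint y; rewrite ?memP ?yL1 //.
have [||q qij [zE vzE]] := endpoint z; rewrite ?memP ?zL2 ?orbT //.
have pq : p != q by have /andP[] := far y z yL1 zL2; rewrite yE zE (inj_eq branch_inj) eq_sym.
rewrite yE in vyE; rewrite zE in vzE; have := common_branch_neighbour pq vyE vzE.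
by rewrite (mem_K4path_swap pij qij pq) (negPf vP).
Qed.

Lemma nonneighbour_reach_end i j v L1 x L2 : i != j -> P i j = L1 ++ x :: L2 ->
  all (nonneighbour e v) (x :: L2) ->
  nonneighbour e v (b j) /\ connect (nonneighbour_edge e v) x (b j).
Proof.
move=> ij PE all_L2; have last_L2 : last x L2 = b j.
  by have := congr1 (last x) PE; rewrite last_cat /= last_rcons => ->.
split; first by rewrite -last_L2 (allP all_L2) // mem_last.
rewrite -last_L2; apply: nonneighbour_walk all_L2.
by have /= := K4path_path ij; rewrite -[path _ _ _]/(sorted e (P i j)) PE => /cat_sorted2[].
Qed.

Lemma nonneighbour_reach_branch v x : nonneighbour e v x ->
  exists2 k, nonneighbour e v (b k) & connect (nonneighbour_edge e v) x (b k).
Proof.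
move=> vx; have [i [j [ij xP]]] := K4path_cover x.
have [L1 [L2 PE]] : exists L1 L2, P i j = L1 ++ x :: L2.
  by case/splitPr: xP => L1 L2; exists L1, L2.
case: (nonneighbour_between ij PE vx) => all_L.
  have revPE : P j i = rev L2 ++ x :: rev L1.
    by rewrite (K4path_rev ij) PE rev_cat rev_cons cat_rcons.
  have [||vi xi] := nonneighbour_reach_end (v := v) _ revPE; first by rewrite eq_sym.
    by rewrite /= vx all_rev.
  by exists i.
have [|vj xj] := nonneighbour_reach_end ij PE (v := v); first by rewrite /= vx.
by exists j.
Qed.

Lemma branches_connect_off_path i j v : i != j -> v \notin P i j ->
  nonneighbour e v (b i) -> nonneighbour e v (b j) ->
  connect (nonneighbour_edge e v) (b i) (b j).
Proof.
move=> ij vP vi vj; rewrite -[b j](last_rcons (b i) (mid i j)).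
apply: nonneighbour_walk; first exact: K4path_path.
rewrite /= vi all_rcons vj /=; apply/allP => x xij; apply/andP; split.
  by apply: contraNneq vP => <-; apply: interior_K4path.
by apply: contraNN vP; rewrite K4_edge_sym; apply: interior_edge.
Qed.

Lemma branches_connect i j v : nonneighbour e v (b i) -> nonneighbour e v (b j) ->
  connect (nonneighbour_edge e v) (b i) (b j).
Proof.
have [->//|ij] := eqVneq i j; move=> vi vj.
have [vP|] := boolP (v \in P i j); last by move=> ?; apply: branches_connect_off_path.
have vij : v \in mid i j.
  move: vP; rewrite mem_K4path => /or3P[/eqP vE|/eqP vE|//].
    by rewrite vE /nonneighbour eqxx in vi.
  by rewrite vE /nonneighbour eqxx in vj.
have [k [l]] := ord4_pair_extend ij; rewrite uniq4E => /and5P[_ ik _ jk _].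
have off p : p \in [:: i; j] -> p != k -> v \notin P p k.
  move=> pij pk; apply/negP => /(interior_in_K4path ij pk vij).
  by case=> -[? ?]; subst; rewrite eqxx in ik jk.
have vk : nonneighbour e v (b k).
  apply/andP; split; first by apply: contraTneq vij => <-; apply: branch_notin_interior.
  apply/negP => /(interior_edge ij vij); rewrite branch_in_K4path // !inE.
  by rewrite ![k == _]eq_sym (negPf ik) (negPf jk).
apply: (@connect_trans _ _ (b k)).
  by apply: branches_connect_off_path; rewrite ?off ?mem_head.
rewrite nonneighbour_connect_sym; last exact: K4_edge_sym.
by apply: branches_connect_off_path; rewrite ?off // !inE eqxx orbT.
Qed.

Lemma nonneighbours_connect v x y : nonneighbour e v x -> nonneighbour e v y ->
  connect (nonneighbour_edge e v) x y.
Proof.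
move=> /nonneighbour_reach_branch[i vi xi] /nonneighbour_reach_branch[j vj yj].
apply: connect_trans xi (connect_trans (branches_connect vi vj) _).
by rewrite nonneighbour_connect_sym //; apply: K4_edge_sym.
Qed.

Lemma not_nonneighbour_branch i j m x : i != j -> m \notin [:: i; j] -> x \in P i j ->
  ~~ nonneighbour e x (b m) -> exists p, [/\ p \in [:: i; j], b p = x & e (b p) (b m)].
Proof.
move=> ij mij xP; rewrite negb_and negbK => /predU1P[mE|/negPn xm].
  by rewrite -mE branch_in_K4path // (negPf mij) in xP.
have [|p pij xE] := K4path_endpoint xP; last by exists p; rewrite -xE.
by apply: contraNN mij => xij; rewrite -branch_in_K4path //; apply: interior_edge ij xij xm.
Qed.

Lemma edge_common_nonneighbour u v : e u v ->
  exists2 w, nonneighbour e u w & nonneighbour e v w.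
Proof.
move=> euv; have /K4_edgeP[i [j [ij uv]]] := euv; have [uP vP] := consec_mem uv.
have [k [l]] := ord4_pair_extend ij; rewrite uniq4E => /and5P[_ ik il jk /andP[jl kl]].
have attached m : m \notin [:: i; j] -> ~~ (nonneighbour e u (b m) && nonneighbour e v (b m)) ->
    exists p, [/\ p \in [:: i; j], b p \in [:: u; v] & e (b p) (b m)].
  move=> mij; rewrite negb_and => /orP[] /not_nonneighbour_branch far.
    by have [p [pij pE pm]] := far i j ij mij uP; exists p; split=> //; rewrite pE mem_head.
  by have [p [pij pE pm]] := far i j ij mij vP; exists p; split=> //; rewrite pE !inE eqxx orbT.
have [/andP[uk vk]|nk] := boolP (nonneighbour e u (b k) && nonneighbour e v (b k)).
  by exists (b k).
have [/andP[ul vl]|nl] := boolP (nonneighbour e u (b l) && nonneighbour e v (b l)).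
  by exists (b l).
have [kij lij] : k \notin [:: i; j] /\ l \notin [:: i; j].
  by rewrite !inE !negb_or ![k == _]eq_sym ![l == _]eq_sym ik jk il jl.
have [p [pij puv pk]] := attached k kij nk; have [q [qij quv ql]] := attached l lij nl.
have [pq|pq] := eqVneq p q.
  by rewrite -pq in ql; rewrite (branch_matching pk ql) eqxx in kl.
have : e (b p) (b q).
  move: puv quv; rewrite !inE => /orP[]/eqP pE /orP[]/eqP qE; rewrite pE qE //.
  - by rewrite -(inj_eq branch_inj) pE qE eqxx in pq.
  - by rewrite K4_edge_sym.
  - by rewrite -(inj_eq branch_inj) pE qE eqxx in pq.
by move/(branch_matching pk) => kE; rewrite kE qij in kij.
Qed.

Lemma encloser_off_branch (F : T -> frame) l : triangle_free e -> frame_layout e F ->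
  exists v x, [/\ frame_inside (F x) (F v), v != b l & forall m, l != m -> v \notin mid l m].
Proof.
move=> tf layout; have [i li] := ord4_neq l.
have [j [k u]] := ord4_pair_extend li.
have uC : uniq (K4cycle i j k) by apply: (@K4cycle_uniq i j k l); rewrite -(rot_uniq 3).
move: u; rewrite uniq4E => /and5P[_ lj lk ij /andP[ik jk]].
have [||v [x [vC xv]]] := cycle_encloser K4_edge_sym K4_edge_irrefl layout tf _ uC.
- by apply: K4cycle_cycle; rewrite // eq_sym.
- by rewrite /= !size_cat /= size_cat /=; lia.
exists v, x; split=> //.
  apply: contraTneq vC => ->; rewrite mem_K4cycle !branch_in_K4path // 1?eq_sym //.
  by rewrite !inE (negPf li) (negPf lj) (negPf lk).
move=> m lm; apply/negP => vlm; move: vC; rewrite mem_K4cycle.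
have off p q : p != q -> l != p -> l != q -> v \notin P p q.
  move=> pq lp lq; apply/negP => /(interior_in_K4path lm pq vlm).
  by case=> -[? ?]; subst; rewrite eqxx in lp lq.
by case/or3P; apply/negP/off; rewrite // eq_sym.
Qed.

Lemma branch_matching_not_restricted : triangle_free e -> ~ restricted_frame_graph e.
Proof.
move=> tf /restricted_frame_graph_layout[F layout].
have unique u v x y : frame_inside (F x) (F u) -> frame_inside (F y) (F v) -> u = v.
  apply: (encloser_unique K4_edge_sym K4_edge_irrefl layout).
  - by move=> w z t; apply: nonneighbours_connect.
  - exact: edge_common_nonneighbour.
have [v [x [xv _ _]]] := encloser_off_branch ord0 tf layout.
have off l : v != b l /\ forall m, l != m -> v \notin mid l m.
  by have [w [y [yw wl wm]]] := encloser_off_branch l tf layout; rewrite (unique _ _ _ _ xv yw).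
have [i [j [ij vP]]] := K4path_cover v.
have [p _ vE] := K4path_endpoint vP ((off i).2 j ij).
by have [] := off p; rewrite vE eqxx.
Qed.

End BranchMatching.

Section TwoUnsubdividedEdges.
Variables (a c d f : 'I_4) (G : seq T) (w : T).
Hypothesis branches : uniq [:: f; a; d; c].
Hypotheses (mid_ac : mid a c = [::]) (mid_ad : mid a d = [::]) (mid_dc : mid d c = rcons G w).

(* Lane 1 runs from [f] through [d] up to the vertex before [w] on the path to [c]. *)
Definition K4_lane (l : nat) : seq T :=
  match l with
  | 0 => rcons (mid f c) (b c)
  | 1 => rcons (mid f d) (b d) ++ G
  | _ => mid f a
  end.

Notation K4_lane_edge := (lane_edge (b f) (b a) w K4_lane (size (mid f d))).

Lemma K4_lane_vertices_perm :
  perm_eq (K4_vertices f a d c) (lane_vertices (b f) (b a) w K4_lane).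
Proof.
apply/permP => p; rewrite /K4_vertices /lane_vertices /= !map_id mid_ac mid_ad mid_dc -!cats1.
by do !rewrite !count_cat /=; lia.
Qed.

Lemma last_K4_lane0 : last (b f) (K4_lane 0) = b c.
Proof. by rewrite /= last_rcons. Qed.

Lemma last_K4_lane1 : last (b f) (K4_lane 1) = last (b d) G.
Proof. by rewrite /= last_cat last_rcons. Qed.

Lemma nth_K4_lane1 : nth (b f) (K4_lane 1) (size (mid f d)) = b d.
Proof. by rewrite /= nth_cat size_rcons ltnSn nth_rcons ltnn eqxx. Qed.

Lemma consec_K4_lane1 x y :
  consec (b f :: K4_lane 1) x y <-> consec (P f d) x y \/ consec (b d :: G) x y.
Proof. by rewrite /K4path /= cat_rcons -cat_cons consec_cat. Qed.

Lemma consec_K4path_dc x y : consec (P d c) x y <->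
  consec (b d :: G) x y \/ (x = last (b d) G /\ y = w \/ x = w /\ y = b c).
Proof. by rewrite /K4path mid_dc !consec_rcons last_rcons; tauto. Qed.

Lemma K4path_lane_edge x y r : r \in K4_edges f a d c -> consec (P r.1 r.2) x y ->
  K4_lane_edge x y \/ K4_lane_edge y x.
Proof.
rewrite /lane_edge nth_K4_lane1 last_K4_lane0 last_K4_lane1.
rewrite !inE => /or4P[||| /or3P[]] /eqP-> /=.
- rewrite consec_rcons => -[|[-> ->]]; first by left; constructor 1; exists 2.
  by right; constructor 2; split=> //; rewrite eqxx !orbT.
- by move=> xy; left; constructor 1; exists 1; rewrite // consec_K4_lane1; left.
- by left; constructor 1; exists 0.
- rewrite /K4path mid_ad consec_cons => -[[-> ->]|/consec_seq1//].
  by left; constructor 2; split=> //; rewrite eqxx orbT.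
- rewrite /K4path mid_ac consec_cons => -[[-> ->]|/consec_seq1//].
  by left; constructor 2; split=> //; rewrite eqxx.
- case/consec_K4path_dc=> [xy|[[-> ->]|[-> ->]]].
  + by left; constructor 1; exists 1; rewrite // consec_K4_lane1; right.
  + by right; constructor 3; split=> //; rewrite eqxx orbT.
  + by left; constructor 3; split=> //; rewrite eqxx.
Qed.

Lemma lane_edge_K4_edge x y : K4_lane_edge x y -> e x y.
Proof.
have edge i j z t : (i, j) \in K4_edges f a d c -> consec (P i j) z t -> e z t.
  by move=> /(K4_edges_neq branches) ij zt; apply/K4_edgeP; exists i, j.
rewrite /lane_edge nth_K4_lane1 last_K4_lane0 last_K4_lane1.
case=> [[[|[|[|//]]] _]|[->]|[->]].
- by apply: edge; rewrite !inE eqxx ?orbT.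
- case/consec_K4_lane1; first by apply: edge; rewrite !inE eqxx ?orbT.
  by move=> xy; apply: (edge d c); [rewrite !inE eqxx ?orbT|apply/consec_K4path_dc; left].
- by move=> xy; apply: (edge f a); [rewrite !inE eqxx|rewrite /K4path consec_rcons; left].
- rewrite !inE => /or3P[]/eqP->.
  + by rewrite branch_edge ?mid_ac // (@K4_edges_neq _ f a d c (a, c)) // !inE eqxx ?orbT.
  + by rewrite branch_edge ?mid_ad // (@K4_edges_neq _ f a d c (a, d)) // !inE eqxx ?orbT.
  + rewrite K4_edge_sym; apply: (edge f a); first by rewrite !inE eqxx.
    by rewrite /K4path consec_rcons; right.
- rewrite !inE => /orP[]/eqP->.
  + by apply: (edge d c); [rewrite !inE eqxx ?orbT|apply/consec_K4path_dc; auto].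
  + rewrite K4_edge_sym; apply: (edge d c); first by rewrite !inE eqxx ?orbT.
    by apply/consec_K4path_dc; auto.
Qed.

Lemma K4_edge_lane_edge x y : e x y <-> K4_lane_edge x y \/ K4_lane_edge y x.
Proof.
split; last by case=> /lane_edge_K4_edge //; rewrite K4_edge_sym.
case/(K4_edge_orientedP _ _ branches)=> r rE [|] /(K4path_lane_edge rE) //.
by case; [right|left].
Qed.

Lemma two_unsubdivided_restricted : restricted_frame_graph e.
Proof.
apply: restricted_frame_graph_of_lanes K4_edge_lane_edge.
- by rewrite -(perm_uniq K4_lane_vertices_perm); apply: K4_vertices_uniq.
- by move=> x; rewrite -(perm_mem K4_lane_vertices_perm); apply: K4_vertices_cover.
- by rewrite size_rcons.
- by rewrite size_cat size_rcons; lia.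
Qed.

End TwoUnsubdividedEdges.

Lemma restricted_share_vertex : triangle_free e -> restricted_frame_graph e ->
  nonsubdivided_share_vertex s.
Proof.
move=> tf restricted; pose shares a c d :=
  [&& a != c, a != d, c != d, ~~ subdivided s a c & ~~ subdivided s a d].
have [/existsP[a /existsP[c /existsP[d /and5P[]]]]|none] :=
  boolP [exists a, exists c, exists d, shares a c d]; first by exists a, c, d.
case: (branch_matching_not_restricted _ tf restricted) => i j k ij ik; apply/eqP/negPn/negP => jk.
have nsub p q : e (b p) (b q) -> p != q /\ ~~ subdivided s p q.
  move=> pq; have ne : p != q by apply: contraTneq pq => ->; rewrite K4_edge_irrefl.
  by rewrite ne subdividedE // -branch_edge // pq.
have [[neij sij] [neik sik]] := (nsub _ _ ij, nsub _ _ ik).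
move/existsPn/(_ i)/existsPn/(_ j)/existsPn/(_ k)/negP: none; apply.
exact/and5P.
Qed.

Lemma share_vertex_restricted : triangle_free e -> nonsubdivided_share_vertex s ->
  restricted_frame_graph e.
Proof.
move=> tf [a [c [d [ac ad cd]]]]; rewrite !subdividedE // !negbK => /eqP mid_ac /eqP mid_ad.
have [|t] := @uniq_extend _ [:: a; d; c].
  by rewrite /= !inE negb_or ac ad eq_sym cd.
rewrite card_ord; case: t => [|f []] // branches _; have dc : d != c by rewrite eq_sym.
case/lastP mid_dc: (mid d c) => [|G w].
  case: (tf (b a) (b c) (b d)).
  by rewrite [e (b c) _]K4_edge_sym [e (b d) (b a)]K4_edge_sym !branch_edge // mid_ac mid_dc mid_ad.
have fadc : uniq [:: f; a; d; c] by rewrite -(rot_uniq 1).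
exact: (two_unsubdivided_restricted fadc mid_ac mid_ad mid_dc).
Qed.

End K4Subdivision.

(** * Counting subdivided edges *)

Lemma sum_unordered_pairs (n : nat) (g : 'I_n -> 'I_n -> nat) : (forall p q, g p q = g q p) ->
  \sum_p \sum_(q | p != q) g p q = (\sum_(r : 'I_n * 'I_n | r.1 < r.2) g r.1 r.2).*2.
Proof.
move=> g_sym; rewrite pair_big_dep (bigID (fun r : 'I_n * 'I_n => r.1 < r.2)) /= -addnn.
have swapK : involutive (fun r : 'I_n * 'I_n => (r.2, r.1)) by case.
congr (_ + _); first by apply: eq_bigl => r; rewrite neq_ltn; case: ltngtP.
rewrite (reindex_inj (inv_inj swapK)) /=; apply: eq_big => r; last by rewrite g_sym.
by rewrite neq_ltn; case: ltngtP.
Qed.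

Lemma sum_K4_edges (i j k l : 'I_4) (g : 'I_4 -> 'I_4 -> nat) : uniq [:: i; j; k; l] ->
    (forall p q, g p q = g q p) ->
  \sum_(r : 'I_4 * 'I_4 | r.1 < r.2) g r.1 r.2 = \sum_(r <- K4_edges i j k l) g r.1 r.2.
Proof.
move=> u g_sym; apply: double_inj; rewrite -(sum_unordered_pairs g_sym).
have enumE : perm_eq (index_enum 'I_4) [:: i; j; k; l].
  apply: (uniq_perm (index_enum_uniq _) u) => x.
  by rewrite mem_index_enum mem_ord4.
rewrite (perm_big _ enumE) /=; under eq_bigr do rewrite (perm_big _ enumE) /=.
move: u; rewrite uniq4E => /and5P[ij ik il jk /andP[jl kl]].
rewrite unlock /= !(eqxx, neq_eqF ij, neq_eqF ik, neq_eqF il, neq_eqF jk, neq_eqF jl, neq_eqF kl).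
rewrite /= (g_sym j i) (g_sym k i) (g_sym l i) (g_sym k j) (g_sym l j) (g_sym l k); lia.
Qed.

Section Counting.
Variables (T : finType) (s : 'I_4 -> 'I_4 -> seq T).

Lemma subdivided_sym (i j : 'I_4) : subdivided s i j = subdivided s j i.
Proof. by rewrite /subdivided; case: ltngtP => // /val_inj->. Qed.

Lemma num_subdividedE (i j k l : 'I_4) : uniq [:: i; j; k; l] ->
  num_subdivided s = \sum_(r <- K4_edges i j k l) subdivided s r.1 r.2.
Proof.
move=> u; rewrite -(sum_K4_edges (g := fun p q => subdivided s p q) u) => [|p q].
  rewrite /num_subdivided -sum1dep_card big_mkcondr.
  by apply: eq_bigr => r _; case: (subdivided s _ _).
by rewrite subdivided_sym.
Qed.

Lemma share_vertex_num_subdivided : nonsubdivided_share_vertex s -> num_subdivided s <= 4.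
Proof.
move=> [a [c [d [ac ad cd /negPf sac /negPf sad]]]].
have [|t] := @uniq_extend _ [:: a; c; d]; first by rewrite /= !inE negb_or ac ad cd.
rewrite card_ord; case: t => [|f []] // u _.
by rewrite (num_subdividedE u) unlock /= sac sad; do !case: subdivided.
Qed.

(* If no two unsubdivided edges meet, then at most one lies in the star of [ord0] and at
   most one in the opposite triangle, so at least four edges are subdivided. *)
Lemma num_subdivided_share_vertex : num_subdivided s <= 3 -> nonsubdivided_share_vertex s.
Proof.
move=> few; have [k [l u]] := @ord4_pair_extend ord0 ord_max isT.
have := u; rewrite uniq4E => /and5P[ij ik il jk /andP[jl kl]].
have share a c d : a != c -> a != d -> c != d ->
    nonsubdivided_share_vertex s \/ subdivided s a c || subdivided s a d.
  move=> ac ad cd; have [|/norP[sac sad]] := boolP (subdivided s a c || _); first by right.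
  by left; exists a, c, d.
have [kj lj lk] : [/\ k != ord_max, l != ord_max & l != k].
  by rewrite ![_ == ord_max]eq_sym [l == k]eq_sym.
have [//|ij_ik] := share _ _ _ ij ik jk; have [//|ij_il] := share _ _ _ ij il jl.
have [//|ik_il] := share _ _ _ ik il kl; have [//|jk_jl] := share _ _ _ jk jl kl.
have [//|] := share _ _ _ kj kl jl; have [//|] := share _ _ _ lj lk jk.
rewrite (subdivided_sym k ord_max) (subdivided_sym l ord_max) (subdivided_sym l k).
move: few ij_ik ij_il ik_il jk_jl; rewrite (num_subdividedE u) unlock /=.
by do !case: subdivided.
Qed.

Lemma nonsubdivided_share_vertexE : nonsubdivided_share_vertex s <->
  num_subdivided s <= 3 \/ num_subdivided s = 4 /\ nonsubdivided_share_vertex s.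
Proof.
split=> [share|[/num_subdivided_share_vertex|[]] //].
by have := share_vertex_num_subdivided share; rewrite leq_eqVlt => /orP[/eqP|]; auto.
Qed.

End Counting.

Theorem theoremA1 (T : finType) (e : rel T) :
  triangle_free e -> is_K4_subdivision e ->
  (restricted_frame_graph e <->
   exists (b : 'I_4 -> T) (s : 'I_4 -> 'I_4 -> seq T),
     K4_subdivision_witness e b s /\
     ((num_subdivided s <= 3)%N \/
      (num_subdivided s = 4 /\ nonsubdivided_share_vertex s))).
Proof.
move=> tf [b [s subK4]]; split=> [restricted|].
  exists b, s; split=> //; apply/nonsubdivided_share_vertexE.
  exact: (restricted_share_vertex subK4).
move=> [b' [s' [subK4' /nonsubdivided_share_vertexE]]].
exact: (share_vertex_restricted subK4').
Qed.
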